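(* Let $2\leq p<\infty$ and $1\leq k\leq n_0=\min\{m,n\}$. Let $A\in\mathbb{M}_{m\times n}(\mathbb{C})$ with $A\ne0$, and let $\mathcal{M}$ be a subspace of $\mathbb{M}_{m\times n}(\mathbb{C})$. If $$\|A\|_{(p,k)}\leq\|A+B\|_{(p,k)}\quad\text{for all }B\in\mathcal{M},$$ then there exist $n\times n$ density matrices $T_1,\ldots,T_k$ such that $A^*AT_i=\sigma_i^2(A)T_i$ for each $1\leq i\leq k$, and $$\frac{1}{\|A\|_{(p,k)}^{p-1}}A(A^*A)^{\frac{p-2}{2}}\sum_{i=1}^{k}T_i\in\mathcal{M}^{\perp}.$$
   Context: $\mathbb{M}_{m\times n}(\mathbb{C})$ is the complex vector space of $m\times n$ complex matrices with inner product $\langle X,Y\rangle=\operatorname{tr}(Y^*X)$, and $\mathcal{M}^\perp$ is the orthogonal complement of the (complex linear) subspace $\mathcal{M}$ for this inner product. $n_0=\min\{m,n\}$ and $\sigma_1(A)\ge\cdots\ge\sigma_{n_0}(A)$ are the singular values of $A$. For $1\le p<\infty$ and $1\le k\le n_0$ the Ky Fan $p$-$k$ norm is $\|A\|_{(p,k)}=(\sigma_1^p(A)+\cdots+\sigma_k^p(A))^{1/p}$. A density matrix is a positive semidefinite matrix of trace $1$. For $p=2$, $(A^*A)^{0}$ is the identity matrix. *)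

(* Defs.v *)
From HB Require Import structures.
From mathcomp Require Import all_boot all_order all_algebra.
From mathcomp Require Import all_classical all_reals all_analysis.
From mathcomp.real_closed Require Import complex.

Set Implicit Arguments.
Unset Strict Implicit.
Unset Printing Implicit Defensive.

Import Order.TTheory GRing.Theory Num.Theory.

Local Open Scope ring_scope.
Local Open Scope complex_scope.
Local Open Scope sesquilinear_scope.

Section MatrixDefs.
Variable R : realType.
Implicit Types m n k : nat.

Definition mxdot m n (X Y : 'M[R[i]]_(m, n)) : R[i] := \tr (Y ^t* *m X).

Definition mxperp m n (M : {vspace 'M[R[i]]_(m, n)}) : set 'M[R[i]]_(m, n) :=
  [set X | {in M, forall Y, mxdot X Y = 0}]%classic.

(* The square roots of the min(m, n) largest eigenvalues of A^* A, counted with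
   multiplicity, in nonincreasing order.  Re loses nothing: the eigenvalues of
   the Hermitian matrix A^* A are real. *)
Definition singular_values m n (A : 'M[R[i]]_(m, n)) : seq R :=
  take (minn m n)
    (sort >=%O
      [seq Num.sqrt (complex.Re (spectral_diag (A ^t* *m A) 0 j)) | j : 'I_n]).

(* 0-based: sigma A i is sigma_(i+1)(A). *)
Definition sigma m n (A : 'M[R[i]]_(m, n)) (i : nat) : R :=
  (singular_values A)`_i.

Definition kyfan_norm m n (p : R) (k : nat) (A : 'M[R[i]]_(m, n)) : R :=
  (\sum_(i < k) sigma A i `^ p) `^ p^-1.

Definition psdmx n (T : 'M[R[i]]_n) : Prop :=
  T \is hermsymmx /\ forall v : 'cV[R[i]]_n, 0 <= (v ^t* *m T *m v) 0 0.

Definition density_matrix n (T : 'M[R[i]]_n) : Prop := psdmx T /\ \tr T = 1.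

(* The real power H^s of a positive semidefinite matrix H = P^-1 D P, with P
   unitary and D diagonal, namely P^-1 D^s P.  As powR satisfies 0 `^ 0 = 1 and
   0 `^ s = 0 for s != 0, H^0 is the identity matrix even for a singular H. *)
Definition psd_powmx n (H : 'M[R[i]]_n) (s : R) : 'M[R[i]]_n :=
  invmx (spectralmx H)
    *m diag_mx (map_mx (fun z => (complex.Re z `^ s)%:C) (spectral_diag H))
    *m spectralmx H.

Lemma psd_powmx0 n (H : 'M[R[i]]_n) : psd_powmx H 0 = 1%:M.
Proof.
rewrite /psd_powmx (_ : map_mx _ _ = const_mx 1); last first.
  by apply/rowP => j; rewrite !mxE powRr0.
by rewrite diag_const_mx mulmx1 mulVmx// spectral_unit.
Qed.

End MatrixDefs.

(* Main.v *)
Require Import Defs.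
From HB Require Import structures.
From mathcomp Require Import all_boot all_order all_algebra all_fingroup.
From mathcomp Require Import all_classical all_reals all_analysis.
From mathcomp.real_closed Require Import complex.
From mathcomp Require Import ring lra.
Set Implicit Arguments.
Unset Strict Implicit.
Unset Printing Implicit Defensive.

Import Order.TTheory GRing.Theory Num.Theory.
Import numFieldNormedType.Exports.

Local Open Scope ring_scope.
Local Open Scope complex_scope.
Local Open Scope sesquilinear_scope.

(* Write q = p / 2, H = A^* A, and G(T) = A |A|^(p-2) sum_i T_i.

   For B in M and t > 0, let V be a sorted unitary eigenbasis of X^* X, where
   X = A - t B, with eigenvalues d_i, and let h_i be the i-th diagonal entry of
   V^* H V.  By convexity of x^q and double stochasticity of the squared moduli
   of a unitary matrix, sum_(i<=k) h_i^q <= ||A||^p, which by minimality is at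
   most ||X||^p = sum_(i<=k) d_i^q; the tangent line at d_i then gives
   sum_(i<=k) d_i^(q-1) (h_i - d_i) <= 0.  Dividing by t and letting t go to 0
   produces an orthonormal eigenbasis of H whose rank-one projections T_i
   satisfy Re <G(T), B> <= 0.

   As the admissible T form a compact convex set, on which G is linear, some
   single T makes G(T) orthogonal to M: otherwise the point of the projection of
   G onto M that is closest to 0 would be a B violating this inequality. *)

(** * Convexity inequalities *)

Section RealInequalities.
Variable R : realType.

(* Young's inequality for the conjugate exponents q and q / (q - 1). *)
Lemma powR_tangent (q x y : R) : 1 <= q -> 0 <= x -> 0 <= y ->
  y `^ q + q * y `^ (q - 1) * (x - y) <= x `^ q.
Proof.
rewrite le_eqVlt => /predU1P[<- x0 y0|q1 x0 y0].
  by rewrite subrr powRr0 !powRr1// !mul1r; lra.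
have q0 : 0 < q by lra.
have q10 : 0 < q - 1 by lra.
have c0 : 0 < q / (q - 1) by apply: divr_gt0.
have := conjugate_powR x0 (powR_ge0 y (q - 1)) q0 c0.
rewrite -powRrM mulrCA divff ?mulr1; last by lra.
have -> : q^-1 + (q / (q - 1))^-1 = 1 by field; apply/andP; split; lra.
move=> /(_ erefl) /(ler_wpM2l (ltW q0)).
have -> : q * (x `^ q / q + y `^ q / (q / (q - 1)))
    = x `^ q + (q - 1) * y `^ q by field; apply/andP; split; lra.
have -> : q * y `^ (q - 1) * (x - y)
    = q * (x * y `^ (q - 1)) - q * (y * y `^ (q - 1)) by ring.
by rewrite mulr_powRB1//; lra.
Qed.

(** The tangent line to [x^q] at the mean [h], averaged with the weights [w], loses its linear
    term. *)
Lemma powR_jensen n (w l : 'I_n -> R) (q : R) : 1 <= q ->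
  (forall j, 0 <= w j) -> \sum_j w j = 1 -> (forall j, 0 <= l j) ->
  (\sum_j w j * l j) `^ q <= \sum_j w j * l j `^ q.
Proof.
move=> q1 w0 w1 l0; set h := \sum_j w j * l j.
have h0 : 0 <= h by apply: sumr_ge0 => j _; rewrite mulr_ge0.
apply: (@le_trans _ _ (\sum_j w j * (h `^ q + q * h `^ (q - 1) * (l j - h)))).
  under eq_bigr => j _.
    rewrite (_ : _ * _ = w j * (h `^ q - q * h `^ (q - 1) * h)
      + q * h `^ (q - 1) * (w j * l j)); last by ring.
    over.
  by rewrite big_split/= -mulr_suml -mulr_sumr w1 -/h; lra.
by apply: ler_sum => j _; rewrite ler_wpM2l// powR_tangent.
Qed.

(** The partial column sums [w j] lie in [[0, 1]] and add up to [k], so against a nonincreasing [mu]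
    nothing beats full weight on the first [k] indices. *)
Lemma doubly_stochastic_sum_le n k (W : 'I_n -> 'I_n -> R) (mu : nat -> R) :
  (k <= n)%N ->
  (forall i j, 0 <= W i j) -> (forall i, \sum_j W i j = 1) ->
  (forall j, \sum_i W i j = 1) ->
  (forall i j : 'I_n, (i <= j)%N -> mu j <= mu i) ->
  \sum_(i < n | (i < k)%N) \sum_j W i j * mu j <= \sum_(i < n | (i < k)%N) mu i.
Proof.
case: k => [|k] kn W0 Wr Wc mono; first by rewrite !big_pred0.
pose w j := \sum_(i < n | (i < k.+1)%N) W i j.
have w1 j : w j <= 1.
  by rewrite -(Wc j) [leRHS](bigID (fun i : 'I_n => i < k.+1)%N)/= lerDl sumr_ge0.
have w0 j : 0 <= w j by rewrite sumr_ge0.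
have sw : \sum_j w j = \sum_(i < n | (i < k.+1)%N) 1.
  by rewrite exchange_big/=; apply: eq_bigr => i _; rewrite Wr.
rewrite exchange_big/=; under eq_bigr do rewrite -mulr_suml.
rewrite -/w.
(* Subtracting the pivot [mu k], the last value kept now that [k] stands for its predecessor, fixes
   the signs: [w i <= 1] multiplies a nonnegative number up to [k], and [w i >= 0] a nonpositive one
   beyond. *)
have -> : \sum_(i < n) w i * mu i = \sum_(i < n) w i * (mu i - mu k)
    + mu k * \sum_j w j.
  by rewrite mulr_sumr -big_split; apply: eq_bigr => i _ /=; ring.
have -> : \sum_(i < n | (i < k.+1)%N) mu i =
    \sum_(i < n | (i < k.+1)%N) (mu i - mu k) + mu k * \sum_j w j.
  by rewrite sw mulr_sumr -big_split; apply: eq_bigr => i _ /=; ring.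
rewrite lerD2r [leRHS]big_mkcond; apply: ler_sum => i _ /=.
case: ltnP => ik.
  have := mono i (Ordinal kn) ik; have := w1 i => /= w1i mui.
  by rewrite ler_piMl ?subr_ge0.
by have := mono (Ordinal kn) i (ltnW ik) => /= muk; rewrite mulr_ge0_le0 ?subr_le0.
Qed.

End RealInequalities.

(** * Limits of complex matrices along an ultrafilter *)

Section UltraLimits.
Local Open Scope classical_set_scope.
Variable R : realType.

(** If a set of a finer filter [G] had its preimage outside [F], the preimage of its complement
    would be in [F], and [G] would contain two disjoint sets. *)
Lemma fmap_ultra (S T : Type) (f : S -> T) (F : set_system S) :
  UltraFilter F -> UltraFilter (f @ F).
Proof.
move=> FU; split; first exact: fmap_proper_filter.
move=> G GP sFG; rewrite predeqE => A; split; last exact: sFG.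
move=> GA; have [//|FnA] := in_ultra_setVsetC (f @^-1` A) FU.
have : G (A `&` ~` A) by apply: filterI => //; apply: sFG.
by rewrite setICr => /filter_ex[].
Qed.

Context {U : set_system nat} {UU : UltraFilter U}.

Lemma bounded_ultra_cvg (u : nat -> R) (b : R) :
  (forall j, `|u j| <= b) -> exists l : R, u @ U --> l.
Proof.
move=> ub; have := @segment_compact R (- b) b; rewrite compact_ultra.
have uab : (u @ U) `[- b, b].
  by apply: (@filterS _ U _ setT) filterT => j _ /=; rewrite in_itv/= -ler_norml.
by move=> /(_ (u @ U) (fmap_ultra u UU) uab)[l [_ ul]]; exists l.
Qed.

Lemma ultra_cvg_le (u v : nat -> R) (a b : R) :
  u @ U --> a -> v @ U --> b -> (forall j, u j <= v j) -> a <= b.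
Proof. by move=> ua vb uv; apply: ler_cvg_to ua vb _; exact: nearW. Qed.

Lemma ultra_cvg_uniq (u : nat -> R) (a b : R) : u @ U --> a -> u @ U --> b -> a = b.
Proof.
by move=> ua ub; apply/eqP; rewrite eq_le !(ultra_cvg_le ua ub, ultra_cvg_le ub ua).
Qed.

Lemma cvg_sum_ord (I : finType) (P : pred I) (u : I -> nat -> R) (l : I -> R) :
  (forall i, P i -> u i @ U --> l i) ->
  (fun j => \sum_(i | P i) u i j) @ U --> \sum_(i | P i) l i.
Proof. by move=> ul; apply: cvg_big => //; exact: add_continuous. Qed.

(** Exponent 0 gives the constant 1, the case that [p = 2] calls for; near a positive limit [powR]
    is [expR (r * ln x)], and at limit 0 monotonicity of the power gives the estimate directly. *)
Lemma cvg_powR (u : nat -> R) (l r : R) : 0 <= r -> (forall j, 0 <= u j) ->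
  u @ U --> l -> (fun j => u j `^ r) @ U --> l `^ r.
Proof.
rewrite le_eqVlt => /predU1P[<- _ _|r0 u0 ul].
  by rewrite powRr0; under eq_cvg do rewrite powRr0; exact: cvg_cst.
have l0 : 0 <= l by apply: (ultra_cvg_le _ ul u0); exact: cvg_cst.
move: l0; rewrite le_eqVlt => /predU1P[l0|l0]; last first.
  have : (fun x => expR (r * ln x)) x @[x --> l] --> expR (r * ln l).
    apply: cvg_comp; last exact: continuous_expR.
    by apply: cvgM; [exact: cvg_cst|exact: continuous_ln].
  move=> /(cvg_comp _ _ ul); rewrite {2}/powR gt_eqF//; apply: cvg_trans.
  apply: near_eq_cvg; near=> j.
  by rewrite /= /powR gt_eqF//; near: j; apply: (cvgr_gt _ ul).
rewrite -l0 in ul *; rewrite powR0 ?gt_eqF//.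
apply/cvgrPdist_le => e e0.
have e'0 : 0 < e `^ r^-1 by rewrite powR_gt0.
have /cvgrPdist_le/(_ _ e'0) := ul; apply: filterS => j.
rewrite !sub0r !normrN !ger0_norm ?powR_ge0// => ue.
have : (u j) `^ r <= (e `^ r^-1) `^ r.
  by apply: ge0_ler_powR; rewrite ?nnegrE ?powR_ge0// ltW.
by rewrite -powRrM mulVf ?gt_eqF// powRr1// ltW.
Unshelve. all: by end_near. Qed.

(** Convergence is tested on real and imaginary parts, so that compactness and order arguments take
    place in [R]. *)
Definition cplx_lim (u : nat -> R[i]) (l : R[i]) :=
  ((fun j => complex.Re (u j)) @ U --> complex.Re l) /\
  ((fun j => complex.Im (u j)) @ U --> complex.Im l).

Definition mx_lim m n (X : nat -> 'M[R[i]]_(m, n)) (L : 'M[R[i]]_(m, n)) :=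
  forall a b, cplx_lim (fun j => X j a b) (L a b).

Lemma cplx_lim_cst c : cplx_lim (fun=> c) c.
Proof. by split; exact: cvg_cst. Qed.

Lemma cplx_lim_uniq u a b : cplx_lim u a -> cplx_lim u b -> a = b.
Proof.
move=> [a1 a2] [b1 b2]; apply/eqP.
by rewrite eq_complex (ultra_cvg_uniq a1 b1) (ultra_cvg_uniq a2 b2) !eqxx.
Qed.

Lemma cplx_limD u v a b : cplx_lim u a -> cplx_lim v b ->
  cplx_lim (fun j => u j + v j) (a + b).
Proof.
move=> [a1 a2] [b1 b2]; split; rewrite raddfD/=.
  by under eq_cvg do rewrite raddfD/=; exact: cvgD.
by under eq_cvg do rewrite raddfD/=; exact: cvgD.
Qed.

Lemma complex_ReM (x y : R[i]) : complex.Re (x * y) =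
  complex.Re x * complex.Re y - complex.Im x * complex.Im y.
Proof. by case: x y => [a b] [c d]. Qed.

Lemma complex_ImM (x y : R[i]) : complex.Im (x * y) =
  complex.Re x * complex.Im y + complex.Im x * complex.Re y.
Proof. by case: x y => [a b] [c d]. Qed.

Lemma cplx_limM u v a b : cplx_lim u a -> cplx_lim v b ->
  cplx_lim (fun j => u j * v j) (a * b).
Proof.
move=> [a1 a2] [b1 b2]; split; rewrite (complex_ReM, complex_ImM).
  by under eq_cvg do rewrite complex_ReM; apply: cvgB; exact: cvgM.
by under eq_cvg do rewrite complex_ImM; apply: cvgD; exact: cvgM.
Qed.

Lemma complex_Re_conj (x : R[i]) : complex.Re x^*%R = complex.Re x.
Proof. by case: x. Qed.

Lemma complex_Im_conj (x : R[i]) : complex.Im x^*%R = - complex.Im x.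
Proof. by case: x. Qed.

Lemma cplx_lim_conj u a : cplx_lim u a -> cplx_lim (fun j => (u j)^*%R) (a^*%R).
Proof.
move=> [a1 a2]; split; rewrite (complex_Re_conj, complex_Im_conj).
  by under eq_cvg do rewrite complex_Re_conj.
by under eq_cvg do rewrite complex_Im_conj; exact: cvgN.
Qed.

Lemma cplx_lim_real (u : nat -> R) (a : R) : u @ U --> a ->
  cplx_lim (fun j => (u j)%:C) a%:C.
Proof. by move=> ua; split => //=; exact: cvg_cst. Qed.

Lemma cplx_lim_sum (I : finType) (P : pred I) (u : I -> nat -> R[i]) (l : I -> R[i]) :
  (forall i, P i -> cplx_lim (u i) (l i)) ->
  cplx_lim (fun j => \sum_(i | P i) u i j) (\sum_(i | P i) l i).
Proof.
move=> ul; split; rewrite raddf_sum/=; under eq_cvg do rewrite raddf_sum/=;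
  by apply: cvg_sum_ord => i /ul[].
Qed.

Lemma mx_lim_cst m n (X : 'M[R[i]]_(m, n)) : mx_lim (fun=> X) X.
Proof. by move=> a b; exact: cplx_lim_cst. Qed.

Lemma mx_lim_uniq m n (X : nat -> 'M[R[i]]_(m, n)) L L' :
  mx_lim X L -> mx_lim X L' -> L = L'.
Proof. by move=> XL XL'; apply/matrixP => a b; exact: cplx_lim_uniq. Qed.

Lemma mx_limD m n (X Y : nat -> 'M[R[i]]_(m, n)) L K :
  mx_lim X L -> mx_lim Y K -> mx_lim (fun j => X j + Y j) (L + K).
Proof.
move=> XL YK a b; rewrite mxE.
rewrite (_ : (fun j => _) = fun j => X j a b + Y j a b).
  exact: cplx_limD.
by apply/funext => j; rewrite mxE.
Qed.

Lemma mx_limM m n p (X : nat -> 'M[R[i]]_(m, n)) (Y : nat -> 'M[R[i]]_(n, p)) L K :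
  mx_lim X L -> mx_lim Y K -> mx_lim (fun j => X j *m Y j) (L *m K).
Proof.
move=> XL YK a b; rewrite mxE.
rewrite (_ : (fun j => _) = fun j => \sum_i X j a i * Y j i b).
  by apply: cplx_lim_sum => i _; exact: cplx_limM.
by apply/funext => j; rewrite mxE.
Qed.

Lemma mx_limZ m n (c : nat -> R[i]) (X : nat -> 'M[R[i]]_(m, n)) l L :
  cplx_lim c l -> mx_lim X L -> mx_lim (fun j => c j *: X j) (l *: L).
Proof.
move=> cl XL a b; rewrite mxE.
rewrite (_ : (fun j => _) = fun j => c j * X j a b); first exact: cplx_limM.
by apply/funext => j; rewrite mxE.
Qed.

Lemma mx_lim_trmxC m n (X : nat -> 'M[R[i]]_(m, n)) L :
  mx_lim X L -> mx_lim (fun j => X j ^t*) (L ^t*).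
Proof.
move=> XL a b; rewrite !mxE.
rewrite (_ : (fun j => _) = fun j => (X j b a)^*%R); first exact: cplx_lim_conj.
by apply/funext => j; rewrite !mxE.
Qed.

Lemma mx_lim_trace n (X : nat -> 'M[R[i]]_n) L :
  mx_lim X L -> cplx_lim (fun j => \tr (X j)) (\tr L).
Proof. by move=> XL; apply: cplx_lim_sum => i _; exact: XL. Qed.

Lemma mx_lim_sum m n (I : finType) (X : I -> nat -> 'M[R[i]]_(m, n)) L :
  (forall i, mx_lim (X i) (L i)) ->
  mx_lim (fun j => \sum_i X i j) (\sum_i L i).
Proof.
move=> XL a b; rewrite summxE.
rewrite (_ : (fun j => _) = fun j => \sum_i X i j a b).
  by apply: cplx_lim_sum => i _; exact: XL.
by apply/funext => j; rewrite summxE.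
Qed.

Lemma bounded_mx_lim m n (X : nat -> 'M[R[i]]_(m, n)) (c : R) :
  (forall j a b, `|complex.Re (X j a b)| <= c /\ `|complex.Im (X j a b)| <= c) ->
  exists L, mx_lim X L.
Proof.
move=> Xc.
have /choice[f fP] : forall ab, exists l, cplx_lim (fun j => X j ab.1 ab.2) l.
  move=> [a b].
  have [|x xP] := @bounded_ultra_cvg (fun j => complex.Re (X j a b)) c.
    by move=> j; have [] := Xc j a b.
  have [|y yP] := @bounded_ultra_cvg (fun j => complex.Im (X j a b)) c.
    by move=> j; have [] := Xc j a b.
  by exists (x +i* y).
by exists (\matrix_(a, b) f (a, b)) => a b; rewrite mxE; exact: (fP (a, b)).
Qed.

End UltraLimits.

(** * Sorted unitary eigenbases of Gram matrices *)

Section EigenFrames.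
Variable R : realType.

(** The columns of [V] are orthonormal eigenvectors of [H]. The eigenvalues are indexed by [nat] so
    that sums over ['I_k] and ['I_n] can share them. *)
Definition eigenframe n (H V : 'M[R[i]]_n) (d : nat -> R) : Prop :=
  [/\ V \is unitarymx, H *m V = V *m diag_mx (\row_j (d j)%:C),
      forall i j : 'I_n, (i <= j)%N -> d j <= d i
    & forall i : 'I_n, 0 <= d i].

Definition sqmod (z : R[i]) : R := complex.Re z ^+ 2 + complex.Im z ^+ 2.

Lemma sqmod_ge0 z : 0 <= sqmod z.
Proof. by rewrite addr_ge0 ?sqr_ge0. Qed.

Lemma sqmodE z : (sqmod z)%:C = z^*%R * z.
Proof. by rewrite mulrC -normCK /sqmod add_Re2_Im2. Qed.

Lemma trmxC_mul m n p (X : 'M[R[i]]_(m, n)) (Y : 'M[R[i]]_(n, p)) :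
  (X *m Y)^t* = Y^t* *m X^t*.
Proof. by rewrite trmx_mul map_mxM. Qed.

Lemma trmxCK m n (X : 'M[R[i]]_(m, n)) : X^t*^t* = X.
Proof. by apply/matrixP => a b; rewrite !mxE conjCK. Qed.

Lemma trmxCE m n (X : 'M[R[i]]_(m, n)) i j : (X^t*) i j = (X j i)^*%R.
Proof. by rewrite !mxE. Qed.

Lemma trmxCD m n (X Y : 'M[R[i]]_(m, n)) : (X + Y)^t* = X^t* + Y^t*.
Proof. by rewrite linearD/= map_mxD. Qed.

Lemma trmxCZ m n c (X : 'M[R[i]]_(m, n)) : (c *: X)^t* = c^*%R *: X^t*.
Proof. by rewrite linearZ/= map_mxZ. Qed.

Lemma gram_diagE m n (X : 'M[R[i]]_(m, n)) j :
  (X^t* *m X) j j = (\sum_i sqmod (X i j))%:C.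
Proof.
by rewrite mxE rmorph_sum; apply: eq_bigr => i _; rewrite !mxE -sqmodE.
Qed.

Lemma gram_hermsym m n (X : 'M[R[i]]_(m, n)) : X^t* *m X \is hermsymmx.
Proof. by apply/is_hermitianmxP; rewrite expr0 scale1r trmxC_mul trmxCK. Qed.

Lemma unitarymxPl n (V : 'M[R[i]]_n) : V \is unitarymx -> V^t* *m V = 1%:M.
Proof. by rewrite -trmxC_unitary => /unitarymxP; rewrite trmxCK. Qed.

(** The adjoint of [spectralmx], its columns permuted as the sorting dictates, is such a frame. The
    bound on [i] reflects the truncation of [singular_values]. *)
Lemma singular_eigenframe m n (X : 'M[R[i]]_(m, n)) : exists V d,
  eigenframe (X^t* *m X) V d /\
  forall i, (i < minn m n)%N -> 0 <= sigma X i /\ sigma X i ^+ 2 = d i.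
Proof.
set H := X^t* *m X; set P := spectralmx H; set sp := spectral_diag H.
have HP : H = P^t* *m diag_mx sp *m P.
  rewrite -invmx_unitary ?spectral_unitarymx//.
  exact/orthomx_spectralP/hermitian_normalmx/gram_hermsym.
have PU : P \is unitarymx by exact: spectral_unitarymx.
(* The eigenvalues are squared column norms of [X P^*], hence nonnegative reals, so squaring the
   root of the real part recovers them. *)
have DE j : sp 0 j = (\sum_i sqmod ((X *m P^t*) i j))%:C.
  rewrite -gram_diagE trmxC_mul trmxCK mulmxA -(mulmxA P) -/H HP !mulmxA.
  rewrite (unitarymxP PU) mul1mx -mulmxA (unitarymxP PU) mulmx1.
  by rewrite mxE eqxx mulr1n.
pose f (j : 'I_n) := Num.sqrt (complex.Re (sp 0 j)).
have fE j : sp 0 j = (f j ^+ 2)%:C.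
  by rewrite /f sqr_sqrtr DE//= sumr_ge0// => i _; exact: sqmod_ge0.
pose S := sort >=%O [seq f j | j : 'I_n].
have [s Ss] : exists s : 'S_n, S = [tuple f (s i) | i < n].
  have : perm_eq S [tuple f i | i < n] by rewrite perm_sort.
  case/tuple_permP => s ->; exists s; congr (tval _).
  by apply: eq_mktuple => i; rewrite tnth_mktuple.
have SE (i : 'I_n) : S`_i = f (s i).
  by rewrite Ss -tnth_nth tnth_mktuple.
have S0 (i : 'I_n) : 0 <= S`_i by rewrite SE sqrtr_ge0.
have sizeS : size S = n by rewrite Ss size_tuple.
have Smono (i j : 'I_n) : (i <= j)%N -> S`_j <= S`_i.
  move=> ij.
  have srt : sorted >=%O S by apply: sort_sorted => x y; exact: le_total.
  apply: (sorted_leq_nth _ _ _ srt) => //; rewrite ?inE ?sizeS//.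
  - by move=> x y z xy yz; exact: le_trans yz xy.
  - exact: lexx.
exists (col_perm s (P^t*)), (fun i => S`_i ^+ 2); split; last first.
  move=> i imn; rewrite /sigma /singular_values nth_take//; split=> //.
  exact: S0 (Ordinal (leq_trans imn (geq_minr m n))).
split.
- apply/unitarymxP; rewrite -(unitarymxPl PU); apply/matrixP => a b.
  rewrite !mxE [RHS](reindex_inj (@perm_inj _ s)).
  by apply: eq_bigr => j _; rewrite !mxE conjCK.
- apply/matrixP => a b; rewrite mul_mx_diag !mxE SE -fE.
  have /matrixP/(_ a (s b)) : H *m P^t* = P^t* *m diag_mx sp.
    by rewrite {1}HP -!mulmxA (unitarymxP PU) mulmx1.
  rewrite mul_mx_diag !mxE => <-.
  by apply: eq_bigr => j _; rewrite !mxE.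
- by move=> i j ij; rewrite lerXn2r ?nnegrE// Smono.
- by move=> i; rewrite sqr_ge0.
Qed.

Lemma eigenframe_diag n (H V : 'M[R[i]]_n) d : eigenframe H V d ->
  forall i, (V^t* *m H *m V) i i = (d i)%:C.
Proof.
move=> [VU HV _ _] i.
by rewrite -mulmxA HV mulmxA unitarymxPl// mul1mx !mxE eqxx mulr1n.
Qed.

(** Substituting [V = W Z] turns each diagonal entry into a combination of the eigenvalues with
    weights [|Z_ji|^2]. *)
Lemma eigenframe_conj_diag n (H W : 'M[R[i]]_n) d (V : 'M[R[i]]_n) i :
  eigenframe H W d ->
  complex.Re ((V^t* *m H *m V) i i) = \sum_j sqmod ((W^t* *m V) j i) * d j.
Proof.
move=> [WU HW _ _]; set Z := W^t* *m V.
have -> : V^t* *m H *m V = Z^t* *m (diag_mx (\row_j (d j)%:C) *m Z).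
  have -> : V = W *m Z by rewrite mulmxA (unitarymxP WU) mul1mx.
  rewrite trmxC_mul -!mulmxA (mulmxA H) HW -(mulmxA W) (mulmxA _ W).
  by rewrite unitarymxPl// mul1mx.
rewrite mxE raddf_sum; apply: eq_bigr => j _.
rewrite mul_diag_mx !mxE mulrCA -sqmodE -rmorphM/=.
by rewrite mulrC.
Qed.

(* The squared moduli of a unitary matrix are doubly stochastic. *)
Lemma eigenframe_sum_le n k (H W V : 'M[R[i]]_n) d q : (k <= n)%N -> 1 <= q ->
  eigenframe H W d -> V \is unitarymx ->
  \sum_(i < n | (i < k)%N) complex.Re ((V^t* *m H *m V) i i) `^ q
  <= \sum_(i < n | (i < k)%N) d i `^ q.
Proof.
move=> kn q1 HW VU; have [WU _ mono d0] := HW; set Z := W^t* *m V.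
have ZU : Z \is unitarymx by rewrite mul_unitarymx// trmxC_unitary.
pose w (i j : 'I_n) := sqmod (Z j i).
have wr i : \sum_j w i j = 1.
  apply: (@complexI R); rewrite -gram_diagE unitarymxPl//.
  by rewrite mxE eqxx.
have wc j : \sum_i w i j = 1.
  apply: (@complexI R); transitivity ((Z *m Z^t*) j j); last first.
    by rewrite (unitarymxP ZU) mxE eqxx.
  rewrite mxE rmorph_sum; apply: eq_bigr => i _.
  by rewrite trmxCE [RHS]mulrC -sqmodE.
have w0 i j : 0 <= w i j by exact: sqmod_ge0.
have monoq (i j : 'I_n) : (i <= j)%N -> d j `^ q <= d i `^ q.
  move=> ij; apply: ge0_ler_powR; rewrite ?nnegrE//; last exact: mono.
  by rewrite (le_trans ler01).
(* Jensen bounds the power of each diagonal entry by an average of the [d j ^ q]; the doubly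
   stochastic bound is applied to these powers. *)
apply: le_trans (doubly_stochastic_sum_le (mu := fun j => d j `^ q) kn w0 wr wc monoq).
apply: ler_sum => i _; rewrite (eigenframe_conj_diag _ _ HW).
exact: (powR_jensen (w := w i) (l := fun j : 'I_n => d j) q1 (w0 i) (wr i) d0).
Qed.

(** Comparing sums with [q = 1], in both directions, equates all partial sums of [d] and [e];
    consecutive differences give the values. *)
Lemma eigenframe_uniq n (H V W : 'M[R[i]]_n) d e :
  eigenframe H V d -> eigenframe H W e -> forall i : 'I_n, d i = e i.
Proof.
have le_sum V' W' d' e' k : (k <= n)%N ->
    eigenframe H V' d' -> eigenframe H W' e' ->
    \sum_(i < k) d' i <= \sum_(i < k) e' i.
  move=> kn HV HW; rewrite !(big_ord_widen n)//.
  have [VU _ _ d0] := HV; have [_ _ _ e0] := HW.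
  have := eigenframe_sum_le kn (lexx 1) HW VU.
  under eq_bigr => i _ do rewrite (eigenframe_diag HV) powRr1 ?d0//.
  by under [leRHS]eq_bigr => i _ do rewrite powRr1 ?e0//.
move=> HV HW i.
have sum_eq k : (k <= n)%N -> \sum_(i < k) d i = \sum_(i < k) e i.
  by move=> kn; apply/eqP; rewrite eq_le (le_sum _ _ _ _ _ kn HV HW) (le_sum _ _ _ _ _ kn HW HV).
have := sum_eq i.+1 (ltn_ord i).
by rewrite !big_ord_recr/= sum_eq 1?ltnW// => /addrI.
Qed.

(** The power is defined through one chosen diagonalisation; this allows its evaluation on any other
    eigenvectors of [H]. *)
Lemma psd_powmx_eigen n (H V : 'M[R[i]]_n) (d : nat -> R) s :
  H \is hermsymmx -> H *m V = V *m diag_mx (\row_j (d j)%:C) ->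
  psd_powmx H s *m V = V *m diag_mx (\row_j (d j `^ s)%:C).
Proof.
move=> /hermitian_normalmx/orthomx_spectralP HP HV.
set P := spectralmx H in HP *; rewrite /psd_powmx -/P.
have Pu : P \in unitmx by exact: spectral_unit.
have DZ : diag_mx (spectral_diag H) *m (P *m V)
    = P *m V *m diag_mx (\row_j (d j)%:C).
  by rewrite -(mulmxA P V) -HV {2}HP !mulmxA mulmxV// mul1mx.
rewrite -!mulmxA; set D := diag_mx (map_mx _ _).
(* [P V] intertwines the two diagonal matrices, so each nonzero entry forces the corresponding
   eigenvalues to agree, and hence their powers. *)
have -> : D *m (P *m V) = P *m V *m diag_mx (\row_j (d j `^ s)%:C).
  apply/matrixP => a b; move/matrixP/(_ a b) : DZ.
  rewrite !mul_diag_mx !mul_mx_diag !mxE.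
  set z := \sum_(_ < _) _; rewrite [z * (d b)%:C]mulrC => Dz.
  have [->|z0] := eqVneq z 0; first by rewrite mulr0 mul0r.
  by rewrite (mulIf z0 Dz) mulrC.
by rewrite !mulmxA mulVmx// mul1mx.
Qed.

End EigenFrames.

(** * Rank-one spectral projections and limits of eigenbases *)

Section EigenProjections.
Variable R : realType.

Definition eigenproj n (V : 'M[R[i]]_n) (i : 'I_n) : 'M[R[i]]_n :=
  col i V *m (col i V)^t*.

Lemma mul_eigenproj n (G V : 'M[R[i]]_n) (e : nat -> R) i :
  G *m V = V *m diag_mx (\row_j (e j)%:C) ->
  G *m eigenproj V i = (e i)%:C *: eigenproj V i.
Proof.
move=> GV; rewrite /eigenproj mulmxA scalemxAl; congr (_ *m _).
apply/colP => a; move/matrixP/(_ a i) : GV; rewrite mul_mx_diag !mxE mulrC => <-.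
by apply: eq_bigr => j _; rewrite mxE.
Qed.

Lemma eigenproj_trace n (V G : 'M[R[i]]_n) i :
  \tr (G *m eigenproj V i) = (V^t* *m G *m V) i i.
Proof.
rewrite /eigenproj mulmxA mxtrace_mulC /mxtrace big_ord1 mulmxA !mxE.
by apply: eq_bigr => j _; rewrite !mxE; congr (_ * _); apply: eq_bigr => l _; rewrite !mxE.
Qed.

Lemma eigenproj_density n (V : 'M[R[i]]_n) i :
  V \is unitarymx -> density_matrix (eigenproj V i).
Proof.
move=> VU; split; last first.
  by rewrite -[eigenproj _ _]mul1mx eigenproj_trace mulmx1 unitarymxPl// mxE eqxx.
have -> : eigenproj V i = (col i V)^t*^t* *m (col i V)^t* by rewrite trmxCK.
split; first exact: gram_hermsym.
move=> v; rewrite mulmxA -trmxC_mul -mulmxA gram_diagE.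
by rewrite lecR sumr_ge0// => j _; exact: sqmod_ge0.
Qed.

(** Uniqueness of the sorted eigenvalues lets any frame serve, and [sigma^p = (sigma^2)^(p/2)]. *)
Lemma kyfan_normE m n k (p : R) (X : 'M[R[i]]_(m, n)) V d :
  0 < p -> (k <= minn m n)%N -> eigenframe (X^t* *m X) V d ->
  kyfan_norm p k X `^ p = \sum_(i < n | (i < k)%N) d i `^ (p / 2).
Proof.
move=> p0 kmn Xd; have kn := leq_trans kmn (geq_minr m n).
rewrite /kyfan_norm -powRrM mulVf ?gt_eqF// powRr1; last first.
  by apply: sumr_ge0 => i _; exact: powR_ge0.
rewrite (big_ord_widen _ (fun i => sigma X i `^ p) kn); apply: eq_bigr => i ik.
have [W [e [Xe Xs]]] := singular_eigenframe X.
have [s0 <-] : 0 <= sigma X i /\ sigma X i ^+ 2 = d i.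
  by rewrite (eigenframe_uniq Xd Xe); apply: Xs; exact: leq_trans ik kmn.
by rewrite -powR_mulrn// -powRrM mulrC divfK ?pnatr_eq0.
Qed.

Lemma unitary_entry_le1 n (V : 'M[R[i]]_n) a b : V \is unitarymx ->
  `|complex.Re (V a b)| <= 1 /\ `|complex.Im (V a b)| <= 1.
Proof.
move=> /unitarymxPl/matrixP/(_ b b); rewrite gram_diagE mxE eqxx => -[s1].
have : sqmod (V a b) <= 1.
  by rewrite -s1 (bigD1 a)//= lerDl sumr_ge0// => i _; exact: sqmod_ge0.
rewrite /sqmod => v1; split; rewrite -ler_sqr ?nnegrE// real_normK ?num_real// expr1n.
  by rewrite (le_trans _ v1)// lerDl sqr_ge0.
by rewrite (le_trans _ v1)// lerDr sqr_ge0.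
Qed.

Lemma mx_lim_diag (U : set_system nat) (UU : UltraFilter U) n
    (d : nat -> nat -> R) (e : nat -> R) :
  (forall i : 'I_n, ((fun j => d j i) @ U --> e i)%classic) ->
  mx_lim (U := U) (fun j => diag_mx (\row_(i < n) (d j i)%:C))
    (diag_mx (\row_(i < n) (e i)%:C)).
Proof.
move=> de a b; rewrite !mxE; under eq_fun do rewrite !mxE.
have [->|_] := eqVneq a b; last by rewrite mulr0n; exact: cplx_lim_cst.
by rewrite mulr1n; apply: cplx_lim_real; exact: de.
Qed.

(* Along an ultrafilter, unitary eigenbases converge without passing to a
   subsequence; the eigenvalues follow, being the diagonal of [V^* H V]. *)
Lemma eigenframe_lim (U : set_system nat) (UU : UltraFilter U) n
    (H V : nat -> 'M[R[i]]_n) (d : nat -> nat -> R) (K : 'M[R[i]]_n) :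
  mx_lim (U := U) H K -> (forall j, eigenframe (H j) (V j) (d j)) ->
  exists L e, [/\ mx_lim (U := U) V L, eigenframe K L e &
    forall i : 'I_n, ((fun j => d j i) @ U --> e i)%classic].
Proof.
move=> HK Vd.
have [|L VL] := @bounded_mx_lim R U UU n n V 1.
  by move=> j a b; apply: unitary_entry_le1; have [] := Vd j.
(* The diagonal of [L^* K L], extended by 0 outside ['I_n]. *)
pose e i := oapp (fun i : 'I_n => complex.Re ((L^t* *m K *m L) i i)) 0 (insub i).
have de (i : 'I_n) : ((fun j => d j i) @ U --> e i)%classic.
  rewrite /e valK /=.
  have [+ _] := mx_limM (mx_limM (mx_lim_trmxC VL) HK) VL i i.
  by under eq_cvg => j do rewrite (eigenframe_diag (Vd j)).
exists L, e; split => //; split.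
- rewrite -trmxC_unitary; apply/unitarymxP; rewrite trmxCK.
  apply: (mx_lim_uniq (mx_limM (mx_lim_trmxC VL) VL)).
  rewrite (_ : (fun j => _) = fun=> 1%:M); first exact: mx_lim_cst.
  by apply/funext => j; have [/unitarymxPl] := Vd j.
- apply: (mx_lim_uniq (mx_limM HK VL)).
  rewrite (_ : (fun j => _) = fun j => V j *m diag_mx (\row_i (d j i)%:C)).
    by apply: mx_limM => //; exact: mx_lim_diag.
  by apply/funext => j; have [] := Vd j.
- move=> i i' ii'; apply: ultra_cvg_le (de i') (de i) _ => j.
  by have [_ _ + _] := Vd j; apply.
- move=> i; apply: (@ultra_cvg_le R U UU (fun=> 0) _ _ _ _ (de i)); first exact: cvg_cst.
  by move=> j; have [_ _ _] := Vd j; apply.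
Qed.

End EigenProjections.

(** * The descent inequality *)

Section Descent.
Variable R : realType.

Lemma conjC_real (x : R) : (x%:C)^*%R = x%:C.
Proof. exact: conjc_real. Qed.

Lemma mxdot_suml m n (I : finType) (X : I -> 'M[R[i]]_(m, n)) Y :
  mxdot (\sum_i X i) Y = \sum_i mxdot (X i) Y.
Proof. by rewrite /mxdot mulmx_sumr raddf_sum. Qed.

Lemma mxdot_sumr m n (I : finType) X (c : I -> R[i]) (Y : I -> 'M[R[i]]_(m, n)) :
  mxdot X (\sum_i c i *: Y i) = \sum_i (c i)^*%R * mxdot X (Y i).
Proof.
rewrite /mxdot raddf_sum/= map_mx_sum mulmx_suml raddf_sum/=.
by apply: eq_bigr => i _; rewrite trmxCZ -scalemxAl mxtraceZ.
Qed.

Lemma mxdotDl m n (X X' Y : 'M[R[i]]_(m, n)) :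
  mxdot (X + X') Y = mxdot X Y + mxdot X' Y.
Proof. by rewrite /mxdot mulmxDr mxtraceD. Qed.

Lemma mxdotZl m n c (X Y : 'M[R[i]]_(m, n)) :
  mxdot (c *: X) Y = c * mxdot X Y.
Proof. by rewrite /mxdot -scalemxAr mxtraceZ. Qed.

Lemma gram_shift m n (A B : 'M[R[i]]_(m, n)) (c : R[i]) : c^*%R = c ->
  (A + c *: B)^t* *m (A + c *: B)
    - c *: (A^t* *m B + B^t* *m A + c *: (B^t* *m B)) = A^t* *m A.
Proof.
move=> cr; rewrite trmxCD trmxCZ cr mulmxDr !mulmxDl !scalerDr.
rewrite -!scalemxAl -!scalemxAr -[X in X - _]addrA.
by rewrite (addrCA (c *: (B^t* *m A))) (addrA (c *: (A^t* *m B))) addrK.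
Qed.

(** The tangents are taken at the eigenvalues of the perturbed [X] and the term in [B^* B] is kept,
    so the inequality is exact for every [t > 0] and only the limit is left. *)
Lemma eigenframe_descent m n k (q t : R) (A X B : 'M[R[i]]_(m, n)) W V l d :
  (k <= n)%N -> 1 <= q -> 0 < t -> X = A + (- t)%:C *: B ->
  eigenframe (A^t* *m A) W l -> eigenframe (X^t* *m X) V d ->
  \sum_(i < n | (i < k)%N) l i `^ q <= \sum_(i < n | (i < k)%N) d i `^ q ->
  \sum_(i < n | (i < k)%N) d i `^ (q - 1) *
    complex.Re ((V^t* *m (A^t* *m B + B^t* *m A + (- t)%:C *: (B^t* *m B)) *m V) i i)
  <= 0.
Proof.
move=> kn q1 t0 XE Wl Vd ld; set E := _ + _ + _.
have [VU _ _ d0] := Vd.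
pose h i := complex.Re ((V^t* *m (A^t* *m A) *m V) i i).
have h0 i : 0 <= h i.
  rewrite /h mulmxA -trmxC_mul -mulmxA gram_diagE/=.
  by apply: sumr_ge0 => j _; exact: sqmod_ge0.
have AE : A^t* *m A = X^t* *m X - (- t)%:C *: E.
  by rewrite XE gram_shift ?conjC_real.
have hd i : h i - d i = t * complex.Re ((V^t* *m E *m V) i i).
  rewrite /h AE mulmxBr mulmxBl mxE (eigenframe_diag Vd) raddfD/= addrAC subrr add0r.
  by rewrite -scalemxAr -scalemxAl -scaleNr [X in complex.Re X = _]mxE complex_ReM/= opprK oppr0 mul0r subr0.
(* The tangent at [d i], then the comparison of [h] with [l] for the unitary [V], then the
   hypothesis on [l] and [d]. *)
have : \sum_(i < n | (i < k)%N) (d i `^ q + q * d i `^ (q - 1) * (h i - d i))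
    <= \sum_(i < n | (i < k)%N) d i `^ q.
  apply: le_trans ld; apply: le_trans (eigenframe_sum_le kn q1 Wl VU).
  by apply: ler_sum => i _; apply: powR_tangent.
rewrite big_split/= gerDl.
rewrite (eq_bigr (fun i : 'I_n => q * t * (d i `^ (q - 1) *
    complex.Re ((V^t* *m E *m V) i i)))); last by move=> i _; rewrite hd; ring.
have qt0 : 0 < q * t by rewrite mulr_gt0//; lra.
by rewrite -mulr_sumr pmulr_rle0.
Qed.

Lemma descent_direction m n k (p : R) (A B : 'M[R[i]]_(m, n)) :
  2 <= p -> (k <= minn m n)%N ->
  (forall t : R, kyfan_norm p k A <= kyfan_norm p k (A + (- t)%:C *: B)) ->
  exists T : 'I_k -> 'M[R[i]]_n,
    [/\ forall i, density_matrix (T i),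
        forall i, A^t* *m A *m T i = (sigma A i ^+ 2)%:C *: T i
      & complex.Re (mxdot (A *m psd_powmx (A^t* *m A) ((p - 2) / 2)
          *m \sum_(i < k) T i) B) <= 0].
Proof.
move=> p2 kmn Amin; have kn := leq_trans kmn (geq_minr m n).
have p0 : 0 < p by lra.
have q1 : 1 <= p / 2 by lra.
have q10 : 0 <= p / 2 - 1 by lra.
(* Along an ultrafilter finer than the eventual filter, ordinary limits persist and bounded
   sequences converge. *)
have [U [UU ooU]] := ultraFilterLemma (@eventually_filter).
pose t j : R := j.+1%:R^-1.
have t0 j : 0 < t j by rewrite invr_gt0.
have tU : (t @ U --> (0 : R))%classic.
  by move=> N /(@cvg_harmonic R) tN; exact: ooU.
pose X j := A + (- t j)%:C *: B.
have perturb_lim m' n' (Y Z : 'M[R[i]]_(m', n')) :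
    mx_lim (U := U) (fun j => Y + (- t j)%:C *: Z) Y.
  suff : mx_lim (U := U) (fun j => Y + (- t j)%:C *: Z) (Y + (- 0)%:C *: Z).
    by rewrite (_ : (- 0)%:C = 0) ?scale0r ?addr0// oppr0.
  apply: mx_limD; first exact: mx_lim_cst.
  apply: mx_limZ; last exact: mx_lim_cst.
  by apply: cplx_lim_real; exact: cvgN.
have XA := perturb_lim _ _ A B.
have /choice[V /choice[d Vd]] : forall j, exists V, exists d,
    eigenframe ((X j)^t* *m X j) V d.
  by move=> j; have [V [d [? _]]] := singular_eigenframe (X j); exists V, d.
have [L [e [VL Le de]]] := eigenframe_lim UU (mx_limM (mx_lim_trmxC XA) XA) Vd.
have [LU HL _ _] := Le.
have [W [l [Wl sl]]] := singular_eigenframe A.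
(* The limit frame diagonalises [A^* A], so its sorted eigenvalues must be the squared singular
   values. *)
have ewid (i : 'I_k) : sigma A i ^+ 2 = e i.
  rewrite (eigenframe_uniq Le Wl (widen_ord kn i)).
  by apply: (sl i _).2; exact: leq_trans kmn.
exists (fun i => eigenproj L (widen_ord kn i)); split.
- by move=> i; exact: eigenproj_density.
- by move=> i; rewrite (mul_eigenproj _ HL) ewid.
set s := (p - 2) / 2; have sE : s = p / 2 - 1 by rewrite /s; lra.
set E := A^t* *m B + B^t* *m A.
(* [A^* B] and [B^* A] are adjoint, so their diagonal entries in the basis [L] have the same real
   part. *)
have E2 i : complex.Re ((L^t* *m E *m L) i i)
    = 2 * complex.Re ((L^t* *m (B^t* *m A) *m L) i i).
  rewrite /E mulmxDr mulmxDl mxE raddfD/=.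
  have -> : L^t* *m (A^t* *m B) *m L = (L^t* *m (B^t* *m A) *m L)^t*.
    by rewrite !trmxC_mul !trmxCK !mulmxA.
  by rewrite trmxCE complex_Re_conj; ring.
(* On each projection the power of [A^* A] acts as the scalar [e i ^ s], and the trace reads off a
   diagonal entry of [L^* B^* A L]. *)
have dotE : complex.Re (mxdot (A *m psd_powmx (A^t* *m A) s
      *m \sum_(i < k) eigenproj L (widen_ord kn i)) B)
    = \sum_(i < n | (i < k)%N) e i `^ s * complex.Re ((L^t* *m (B^t* *m A) *m L) i i).
  have psdL := psd_powmx_eigen s (gram_hermsym A) HL.
  rewrite mulmx_sumr mxdot_suml raddf_sum/= [RHS](big_ord_narrow kn).
  apply: eq_bigr => i _; rewrite -mulmxA (mul_eigenproj (e := fun i => e i `^ s) _ psdL).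
  rewrite -scalemxAr mxdotZl complex_ReM/= mul0r subr0.
  by rewrite /mxdot (mulmxA _ A) eigenproj_trace.
(* Here [p >= 2] enters: [s] is nonnegative, so the weights converge even where an eigenvalue tends
   to 0. *)
have limsum : ((fun j => \sum_(i < n | (i < k)%N) d j i `^ s *
      complex.Re (((V j)^t* *m (E + (- t j)%:C *: (B^t* *m B)) *m V j) i i)) @ U -->
    \sum_(i < n | (i < k)%N) e i `^ s * complex.Re ((L^t* *m E *m L) i i))%classic.
  apply: cvg_sum_ord => i _; apply: cvgM.
    apply: cvg_powR; [by rewrite sE| |exact: de].
    by move=> j; have [_ _ _] := Vd j; apply.
  have EE := perturb_lim _ _ E (B^t* *m B).
  by have [] := mx_limM (mx_limM (mx_lim_trmxC VL) EE) VL i i.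
have : \sum_(i < n | (i < k)%N) e i `^ s * complex.Re ((L^t* *m E *m L) i i) <= 0.
  apply: ultra_cvg_le limsum (cvg_cst _) _ => j.
  rewrite sE; apply: (eigenframe_descent kn q1 (t0 j) erefl Wl (Vd j)).
  rewrite -(kyfan_normE p0 kmn Wl) -(kyfan_normE p0 kmn (Vd j)).
  by apply: ge0_ler_powR (Amin _); rewrite ?nnegrE ?powR_ge0// ltW.
under eq_bigr => i _ do rewrite E2 mulrCA.
by rewrite -mulr_sumr dotE pmulr_rle0.
Qed.

End Descent.

(** * Density matrices *)

Section DensityMatrices.
Variable R : realType.

(** The quadratic form at [e_a + c e_b]; its two cross terms are conjugate because [T] is
    Hermitian. *)
Lemma psdmx_quad n (T : 'M[R[i]]_n) a b (c : R[i]) : psdmx T ->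
  0 <= complex.Re (T a a) + complex.Re (c^*%R * c * T b b)
    + 2 * complex.Re (c * T a b).
Proof.
move=> [/is_hermitianmxP]; rewrite expr0 scale1r => Th.
pose e (x : 'I_n) : 'cV[R[i]]_n := delta_mx x 0.
have ent x y : ((e x)^t* *m T *m e y) 0 0 = T x y.
  by rewrite /e trmx_delta map_delta_mx -rowE -colE !mxE.
have combE (P Q S W : 'M[R[i]]_1) x y z :
    (P + x *: Q + (y *: S + z *: W)) 0 0 = P 0 0 + x * Q 0 0 + (y * S 0 0 + z * W 0 0).
  by rewrite !mxE.
move=> /(_ (e a + c *: e b)).
rewrite trmxCD trmxCZ !mulmxDl !mulmxDr -!scalemxAl -!scalemxAr scalerA.
rewrite combE !ent.
have -> : T b a = (T a b)^*%R by rewrite {1}Th trmxCE.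
rewrite -rmorphM lecE => /andP[_]; rewrite !raddfD/= complex_Re_conj.
by move=> q0; apply: le_trans q0 _; rewrite le_eqVlt; apply/orP; left; apply/eqP; ring.
Qed.

Lemma density_entry_le1 n (T : 'M[R[i]]_n) a b : density_matrix T ->
  `|complex.Re (T a b)| <= 1 /\ `|complex.Im (T a b)| <= 1.
Proof.
move=> [Tpsd Ttr].
have T0 x : 0 <= complex.Re (T x x).
  by have := psdmx_quad x x 0 Tpsd; rewrite !(mulr0, mul0r)/= !addr0.
have T1 x : complex.Re (T x x) <= 1.
  have -> : 1 = \sum_y complex.Re (T y y) by rewrite -[LHS]/(complex.Re 1) -Ttr raddf_sum.
  by rewrite (bigD1 x)//= lerDl sumr_ge0.
(* For [|c| = 1] the forms at [c] and [- c] bound [2 |Re (c T_ab)|] by [T_aa + T_bb <= 2]; [c = 1]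
   and [c = i] then give the two parts. *)
have qc c : c^*%R * c = 1 -> `|complex.Re (c * T a b)| <= 1.
  move=> c1; have := psdmx_quad a b c Tpsd; have := psdmx_quad a b (- c) Tpsd.
  rewrite rmorphN mulrNN c1 !mul1r mulNr raddfN/=.
  by have := T1 a; have := T1 b; rewrite ler_norml; lra.
split; first by rewrite -[T a b]mul1r qc// rmorph1 mulr1.
rewrite -normrN -ReiNIm mulrC qc//.
by apply/eqP; rewrite eq_complex/=; apply/andP; split; apply/eqP; ring.
Qed.

Lemma density_lim (U : set_system nat) (UU : UltraFilter U) n
    (X : nat -> 'M[R[i]]_n) L :
  mx_lim (U := U) X L -> (forall j, density_matrix (X j)) -> density_matrix L.
Proof.
move=> XL Xd; split; [split|].
- apply/is_hermitianmxP; rewrite expr0 scale1r.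
  apply: (mx_lim_uniq XL); rewrite (_ : X = fun j => (X j)^t*).
    exact: mx_lim_trmxC.
  by apply/funext => j; have [[/is_hermitianmxP + _] _] := Xd j; rewrite expr0 scale1r.
- move=> v; have vXv : mx_lim (U := U) (fun j => v^t* *m X j *m v) (v^t* *m L *m v).
    by apply: mx_limM (mx_lim_cst v); apply: mx_limM XL; exact: mx_lim_cst.
  have [Rel Iml] := vXv 0 0.
  have Xv j : 0 <= ((v^t* *m X j *m v) 0 0) by have [[_ ->]] := Xd j.
  (* Nonnegativity in [R[i]] includes being real, so the imaginary part is passed to the limit as
     well. *)
  rewrite lecE/=; apply/andP; split.
    apply/eqP; apply: ultra_cvg_uniq Iml _.
    have XvIm j : complex.Im ((v^t* *m X j *m v) 0 0) = 0.
      by have := Xv j; rewrite lecE => /andP[/eqP].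
    under eq_cvg do rewrite XvIm.
    exact: cvg_cst.
  apply: ultra_cvg_le (cvg_cst _) Rel _ => j.
  by have := Xv j; rewrite lecE => /andP[].
- apply: (cplx_lim_uniq (mx_lim_trace XL)).
  have Xt j : \tr (X j) = 1 by have [] := Xd j.
  under eq_fun do rewrite Xt.
  exact: cplx_lim_cst.
Qed.

Lemma density_convex n (S T : 'M[R[i]]_n) (s : R) : 0 <= s <= 1 ->
  density_matrix S -> density_matrix T ->
  density_matrix ((1 - s)%:C *: S + s%:C *: T).
Proof.
move=> /andP[s0 s1] [[Sh Sp] St] [[Th Tp] Tt]; split; [split|].
- apply/is_hermitianmxP; move: Sh Th => /is_hermitianmxP + /is_hermitianmxP.
  rewrite !expr0 !scale1r trmxCD !trmxCZ !conjC_real => Sh Th.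
  by rewrite {1}Sh {1}Th.
- move=> v; rewrite mulmxDr mulmxDl -!scalemxAr -!scalemxAl.
  have combE (P Q : 'M[R[i]]_1) x y : (x *: P + y *: Q) 0 0 = x * P 0 0 + y * Q 0 0.
    by rewrite !mxE.
  by rewrite combE addr_ge0// mulr_ge0// lecR// subr_ge0.
- by rewrite mxtraceD !mxtraceZ St Tt !mulr1 -rmorphD/= subrK.
Qed.

(** Expansion of [|z + s (w - z)|^2] in powers of [s]. *)
Lemma sqmod_convex (s : R) (z w : R[i]) :
  sqmod ((1 - s)%:C * z + s%:C * w)
  = sqmod z + 2 * s * (complex.Re (z^*%R * w) - sqmod z) + s ^+ 2 * sqmod (w - z).
Proof. by case: z w => [a b] [c d]; rewrite /sqmod /=; ring. Qed.

(** The quadratic has slope [2 (r - N) <= - 2 N] at 0, so a positive [N] would let it drop below its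
    starting value. *)
Lemma quadratic_min (N r C : R) : 0 <= N -> 0 <= C -> r <= 0 ->
  (forall s, 0 <= s <= 1 -> N <= N + 2 * s * (r - N) + s ^+ 2 * C) -> N = 0.
Proof.
move=> N0 C0 r0 Nmin; apply/eqP; rewrite eq_le N0 andbT leNgt; apply/negP => Npos.
have NC : 0 < N + C by lra.
(* At [s = N / (N + C)] one has [s C <= N], so the decrease is at least [s N]. *)
have s0 : 0 < N / (N + C) by rewrite divr_gt0.
have s1 : N / (N + C) <= 1 by rewrite ler_pdivrMr//; lra.
have sC : N / (N + C) * C <= N by rewrite mulrAC ler_pdivrMr//; nra.
have := Nmin (N / (N + C)); rewrite s1 ltW//= => /(_ isT).
by set s := N / _ in s0 s1 sC *; nra.
Qed.

End DensityMatrices.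

(** * Least squares over the admissible tuples *)

Section Minimisation.
Variable R : realType.

Lemma ex_ultra_harmonic : exists U : set_system nat,
  UltraFilter U /\ ((fun j => j.+1%:R^-1 : R) @ U --> (0 : R))%classic.
Proof.
have [U [UU ooU]] := ultraFilterLemma (@eventually_filter).
by exists U; split=> // N /(@cvg_harmonic R) tN; exact: ooU.
Qed.

Lemma mx_lim_mxdot (U : set_system nat) (UU : UltraFilter U) m n
    (X : nat -> 'M[R[i]]_(m, n)) L Y :
  mx_lim (U := U) X L -> cplx_lim (U := U) (fun j => mxdot (X j) Y) (mxdot L Y).
Proof. by move=> XL; apply/mx_lim_trace/mx_limM => //; exact: mx_lim_cst. Qed.

Lemma cvg_sqmod (U : set_system nat) (UU : UltraFilter U) (u : nat -> R[i]) l :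
  cplx_lim (U := U) u l -> ((fun j => sqmod (u j)) @ U --> sqmod l)%classic.
Proof. by move=> [ul1 ul2]; apply: cvgD; rewrite expr2; under eq_cvg do rewrite expr2; exact: cvgM. Qed.

(* The eigenvector condition is linear, so the admissible tuples form a compact
   convex set.  At a minimiser of [sum_l |<Q * sum T_i, b_l>|^2], the direction
   [B = sum_l <Q * sum T_i, b_l> b_l] turns the first-order condition into the
   vanishing of the minimum. *)
Lemma density_separation m n k d (H : 'M[R[i]]_n) (c : 'I_k -> R[i])
    (Q : 'M[R[i]]_(m, n)) (b : 'I_d -> 'M[R[i]]_(m, n)) :
  (forall f : 'I_d -> R[i], exists T : 'I_k -> 'M[R[i]]_n,
    [/\ forall i, density_matrix (T i), forall i, H *m T i = c i *: T i
      & complex.Re (mxdot (Q *m \sum_i T i) (\sum_l f l *: b l)) <= 0]) ->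
  exists T : 'I_k -> 'M[R[i]]_n,
    [/\ forall i, density_matrix (T i), forall i, H *m T i = c i *: T i
      & forall l, mxdot (Q *m \sum_i T i) (b l) = 0].
Proof.
move=> dir.
pose K (T : 'I_k -> 'M[R[i]]_n) :=
  (forall i, density_matrix (T i)) /\ (forall i, H *m T i = c i *: T i).
pose F T l := mxdot (Q *m \sum_(i < k) T i) (b l).
pose N T := \sum_l sqmod (F T l).
have N0 T : 0 <= N T by apply: sumr_ge0 => l _; exact: sqmod_ge0.
pose E : set R := [set N T | T in [set T | K T]]%classic.
have EI : has_inf E.
  split; last by exists 0 => _ [T _ <-].
  by have [T [T1 T2 _]] := dir (fun=> 0); exists (N T), T.
have [U [UU tU]] := ex_ultra_harmonic.
have /choice[T TP] : forall j : nat, exists T, K T /\ N T < inf E + j.+1%:R^-1.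
  move=> j; have tj : 0 < j.+1%:R^-1 :> R by rewrite invr_gt0.
  by have [_ [T KT <-] NT] := inf_adherent tj EI; exists T.
(* Density matrices have bounded entries, so the minimising sequence converges along the
   ultrafilter. *)
have /choice[S TS] : forall i, exists L, mx_lim (U := U) (fun j => T j i) L.
  move=> i; apply: (@bounded_mx_lim R U UU n n _ 1) => j a a'.
  by apply: density_entry_le1; have [[]] := TP j.
have KS : K S.
  split=> i; first by apply: density_lim (TS i) _ => j; have [[]] := TP j.
  apply: (mx_lim_uniq (mx_limM (mx_lim_cst H) (TS i))).
  rewrite (_ : (fun j => _) = fun j => c i *: T j i).
    by apply: mx_limZ (TS i); exact: cplx_lim_cst.
  by apply/funext => j; have [[_ ->]] := TP j.
have NS T' : K T' -> N S <= N T'.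
  move=> KT'; apply: (@le_trans _ _ (inf E)); last first.
    by apply: ge_inf; [exact: EI.2|exists T'].
  have NSU : ((fun j => N (T j)) @ U --> N S)%classic.
    apply: cvg_sum_ord => l _; apply: cvg_sqmod; apply: mx_lim_mxdot.
    by apply: mx_limM (mx_lim_cst _) _; apply: mx_lim_sum.
  have infU : ((fun j : nat => inf E + j.+1%:R^-1) @ U --> inf E + 0)%classic.
    by apply: cvgD => //; exact: cvg_cst.
  rewrite -[leRHS]addr0; apply: ultra_cvg_le NSU infU _ => j.
  by have [_ /ltW] := TP j.
(* As [mxdot] is conjugate linear in its second argument, the coefficients [F S] make the hypothesis
   a bound on the real part of the pairing of [F S] with [F T']. *)
have [T' [T'd T'e T'le]] := dir (F S).
have rle : \sum_l complex.Re ((F S l)^*%R * F T' l) <= 0.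
  by move: T'le; rewrite mxdot_sumr raddf_sum.
have NS0 : N S = 0.
  have C0 : 0 <= \sum_l sqmod (F T' l - F S l).
    by apply: sumr_ge0 => l _; exact: sqmod_ge0.
  apply: (quadratic_min (N0 S) C0 rle) => s s01.
  (* The segment from [S] to [T'] stays admissible, and along it [N] is the quadratic in [s] just
     described. *)
  pose T'' i := (1 - s)%:C *: S i + s%:C *: T' i.
  apply: le_trans (NS T'' _) _.
    split=> i; first by apply: density_convex => //; have [] := KS.
    rewrite mulmxDr -!scalemxAr T'e; have [_ ->] := KS.
    by rewrite scalerDr !scalerA ![c i * _]mulrC.
  have FT'' l : F T'' l = (1 - s)%:C * F S l + s%:C * F T' l.
    rewrite /F big_split/= -!scaler_sumr mulmxDr -!scalemxAr.
    by rewrite mxdotDl; congr (_ + _); exact: mxdotZl.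
  have -> : N T'' = \sum_l (sqmod (F S l) + 2 * s *
      (complex.Re ((F S l)^*%R * F T' l) - sqmod (F S l))
      + s ^+ 2 * sqmod (F T' l - F S l)).
    by apply: eq_bigr => l _; rewrite FT''; exact: sqmod_convex.
  by rewrite big_split/= big_split/= -!mulr_sumr sumrB.
exists S; split; [by have [] := KS|by have [] := KS|] => l.
have /eqP := NS0; rewrite psumr_eq0; last by move=> i _; exact: sqmod_ge0.
move=> /allP/(_ l (mem_index_enum l))/=.
rewrite /sqmod paddr_eq0 ?sqr_ge0// !sqrf_eq0 => /andP[/eqP re0 /eqP im0].
by apply/eqP; rewrite eq_complex -/(F S l) re0 im0 !eqxx.
Qed.

End Minimisation.

(** * From descent in every direction to orthogonality on a basis *)

Theorem theorem2p15 (R : realType) (m n k : nat) (p : R)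
    (A : 'M[R[i]]_(m, n)) (M : {vspace 'M[R[i]]_(m, n)})
    (hp : 2 <= p) (hk : (1 <= k <= minn m n)%N) (hA : A != 0)
    (hmin : forall B, B \in M -> kyfan_norm p k A <= kyfan_norm p k (A + B)) :
  exists T : 'I_k -> 'M[R[i]]_n,
    [/\ forall i, density_matrix (T i),
        forall i, A ^t* *m A *m T i = (sigma A i ^+ 2)%:C *: T i
      & mxperp M ((kyfan_norm p k A `^ (p - 1))^-1%:C *:
          (A *m psd_powmx (A ^t* *m A) ((p - 2) / 2) *m \sum_(i < k) T i))].
Proof.
have kmn : (k <= minn m n)%N by case/andP: hk.
pose b (l : 'I_(\dim M)) := (vbasis M)`_l.
have bM l : b l \in M by rewrite vbasis_mem// mem_nth// size_tuple.
have dir (f : 'I_(\dim M) -> R[i]) := descent_direction (A := A)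
  (B := \sum_l f l *: b l) hp kmn.
have [|T [Td Te Tperp]] := density_separation (b := b) (fun f => dir f _).
  (* [M] is a subspace, so it contains every multiple [- t B]. *)
  by move=> f t; apply: hmin; rewrite memvZ// memv_suml// => l _; rewrite memvZ.
(* Orthogonality to the basis vectors extends to [M] by conjugate linearity. *)
exists T; split => // Y YM; rewrite mxdotZl (coord_vbasis YM) mxdot_sumr.
by rewrite big1 ?mulr0// => l _; rewrite Tperp mulr0.
Qed.
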